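(* Let $\rho(n)$ denote the largest possible cardinality of a spherical two-distance set in $\mathbf{R}^n$ whose inner products $a,b$ satisfy $a+b\ge 0$. If $n\ge 7$ is an integer, then $$\rho(n)=\frac{n(n+1)}{2}.$$
   Context: A spherical two-distance set in $\mathbf{R}^n$ with inner products $a$ and $b$ is a set $S$ of unit vectors in $\mathbf{R}^n$, together with real numbers $a,b$ with $-1\le a,b<1$, such that the inner product of any two distinct vectors of $S$ is either $a$ or $b$. Thus $\rho(n)$ is the maximum of $|S|$ over all such $S$ and all such $a,b$ with $a+b\ge 0$. *)

(* Defs.v *)
From mathcomp Require Import all_boot all_order all_algebra.
From mathcomp Require Import boolp classical_sets functions cardinality reals.

Set Implicit Arguments.
Unset Strict Implicit.
Unset Printing Implicit Defensive.

Import Order.TTheory GRing.Theory Num.Theory.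

Local Open Scope classical_set_scope.
Local Open Scope card_scope.
Local Open Scope ring_scope.

Definition dot (R : realType) (n : nat) (u v : 'rV[R]_n) : R :=
  \sum_(i < n) u 0 i * v 0 i.

(* [a = b] is allowed, and neither value is required to be attained. [S] is not
   assumed to be finite. *)
Definition spherical_two_distance (R : realType) (n : nat)
    (S : set 'rV[R]_n) (a b : R) : Prop :=
  [/\ -1 <= a < 1,
      -1 <= b < 1,
      forall u, S u -> dot u u = 1
    & forall u v, S u -> S v -> u <> v -> dot u v = a \/ dot u v = b].

Definition rho_admissible (R : realType) (n : nat) (S : set 'rV[R]_n) : Prop :=
  exists a b : R, spherical_two_distance S a b /\ 0 <= a + b.

(* [is_rho R n k] reads "rho(n) = k": [k] is attained as a cardinality, and every
   admissible set, a priori possibly infinite, has cardinality at most [k].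
   By [is_rho_unique] it determines [k]. *)
Definition is_rho (R : realType) (n k : nat) : Prop :=
  (exists S : set 'rV[R]_n, rho_admissible S /\ S #= `I_k) /\
  (forall S : set 'rV[R]_n, rho_admissible S -> S #<= `I_k).

Lemma is_rho_unique (R : realType) (n k l : nat) :
  is_rho R n k -> is_rho R n l -> k = l.
Proof.
have le p q : is_rho R n p -> is_rho R n q -> (p <= q)%N.
  move=> [[S [hS cS]] _] [_ /(_ S hS) Sq].
  by rewrite -card_le_II -(card_le_eql cS).
by move=> hk hl; apply/eqP; rewrite eqn_leq !le.
Qed.

(* Main.v *)
(* Upper bound: for points x_i of an admissible set, the symmetric matrices
   x_i^T x_i + ab I are linearly independent, and such matrices form a space of
   dimension n(n+1)/2. Indeed, if sum_i c_i (x_i^T x_i + ab I) = 0, evaluating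
   the quadratic form at x_j gives, since (t - a)(t - b) vanishes at every
   <x_i, x_j> with i <> j,
     c_j (1 - a)(1 - b) + (a + b) <sum_i c_i x_i, x_j> = 0;
   multiplying by c_j and summing,
     (1 - a)(1 - b) sum_j c_j^2 + (a + b) |sum_i c_i x_i|^2 = 0,
   so all c_j vanish because a + b >= 0.
   Lower bound: the normalised midpoints of the edges of a regular simplex with
   N = n + 1 vertices have inner products (N - 4)/(2(N - 2)) and
   -4/(2(N - 2)), whose sum is nonnegative exactly when N >= 8. *)
Require Import Defs.
From mathcomp Require Import all_boot all_order all_algebra.
From mathcomp Require Import boolp classical_sets functions cardinality reals.
From mathcomp Require Import finmap ring lra.

Set Implicit Arguments.
Unset Strict Implicit.
Unset Printing Implicit Defensive.

Import Order.TTheory GRing.Theory Num.Theory.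

Local Open Scope ring_scope.

(** * Counting tools *)

(** This turns a bound on a possibly infinite set into a bound on finite duplicate-free lists: an
    infinite [A] would contain a finite subset with more than [k] elements. *)
Lemma card_le_seq (T : choiceType) (A : set T) (k : nat) :
  (forall s : seq T, uniq s -> (forall x, x \in s -> A x) -> (size s <= k)%N) ->
  (A #<= `I_k)%card.
Proof.
move=> hs; have [finA|infA] := pselect (finite_set A).
  have /finite_setP [m cA] := finA.
  rewrite (card_le_eql cA) card_le_II -(card_fset_set cA).
  by apply: hs => // x; rewrite in_fset_set // => /set_mem.
have [B BA kB] := infinite_set_fset k.+1 infA.
have := hs (enum_fset B) (fset_uniq B) (fun x xB => BA x xB).
by rewrite leqNgt kB.
Qed.

(** These pairs index the entries that determine a symmetric matrix. Counted by columns, column [j]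
    contributes [j.+1] of them, and the sum is the binomial coefficient of [n.+1] over 2. *)
Lemma card_upper_triangle (n : nat) :
  #|[set p : 'I_n * 'I_n | (p.1 <= p.2)%N]| = ((n * (n + 1)) %/ 2)%N.
Proof.
rewrite -sum1dep_card.
rewrite -(pair_big_dep xpredT (fun i j : 'I_n => (i <= j)%N) (fun _ _ => 1%N)) /=.
rewrite (exchange_big_dep xpredT) //=.
rewrite (eq_bigr (fun j : 'I_n => j.+1)); last first.
  move=> j _; rewrite sum1_card -[RHS]card_ord.
  have le : (j.+1 <= n)%N by exact: ltn_ord.
  have winj : injective (widen_ord le) by move=> i i' [] /val_inj.
  rewrite -(card_imset predT winj).
  apply: eq_card => i; apply/idP/imsetP.
    rewrite unfold_in => ij; exists (Ordinal (ij : (i < j.+1)%N)) => //.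
    exact: val_inj.
  by case=> i' _ ->; rewrite unfold_in; exact: (ltn_ord i').
rewrite addn1 divn2 mulnC -(bin2 n.+1) -bin2_sum big_mkord big_ord_recl add0n.
by [].
Qed.

(** * Bilinearity of the inner product and a quadratic form *)

Section Dot.
Variables (R : realType) (n : nat).
Implicit Types u v w : 'rV[R]_n.

Lemma dotC u v : dot u v = dot v u.
Proof. by apply: eq_bigr => i _; rewrite mulrC. Qed.

Lemma dot_suml (I : finType) (P : pred I) (f : I -> 'rV[R]_n) v :
  dot (\sum_(i | P i) f i) v = \sum_(i | P i) dot (f i) v.
Proof.
rewrite /dot exchange_big /=; apply: eq_bigr => k _.
by rewrite summxE mulr_suml.
Qed.

Lemma dot_sumr (I : finType) (P : pred I) (f : I -> 'rV[R]_n) v :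
  dot v (\sum_(i | P i) f i) = \sum_(i | P i) dot v (f i).
Proof. by rewrite dotC dot_suml; apply: eq_bigr => i _; rewrite dotC. Qed.

Lemma dotZl c u v : dot (c *: u) v = c * dot u v.
Proof. by rewrite /dot mulr_sumr; apply: eq_bigr => k _; rewrite mxE mulrA. Qed.

Lemma dotZr c u v : dot u (c *: v) = c * dot u v.
Proof. by rewrite dotC dotZl dotC. Qed.

Lemma dot_ge0 u : 0 <= dot u u.
Proof. by apply: sumr_ge0 => i _; rewrite -expr2 sqr_ge0. Qed.

(** The left side is the quadratic form of the matrix [u^T u + p I] at [v]. Written out in matrix
    entries, it inherits every linear relation that holds entrywise. *)
Lemma dot_sqr_sum u v p :
  dot u v ^+ 2 + p * dot v v =
  \sum_k \sum_l (u 0 k * u 0 l + p * (k == l)%:R) * (v 0 k * v 0 l).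
Proof.
rewrite expr2 /dot mulr_suml mulr_sumr -big_split; apply: eq_bigr => k _ /=.
rewrite mulr_sumr [RHS](eq_bigr (fun l => u 0 k * v 0 k * (u 0 l * v 0 l) +
  p * (k == l)%:R * (v 0 k * v 0 l))); last by move=> l _; ring.
rewrite big_split; congr (_ + _); rewrite (bigD1 k) //= eqxx mulr1 big1 ?addr0 //.
by move=> l /negPf; rewrite eq_sym => ->; rewrite mulr0 mul0r.
Qed.

End Dot.

(** * Upper bound *)

Lemma sum_sqr_eq0 (R : realType) (m : nat) (c : 'I_m -> R) :
  \sum_i c i ^+ 2 = 0 -> forall i, c i = 0.
Proof.
move=> /eqP; rewrite psumr_eq0 => [/allP h i|i _]; last exact: sqr_ge0.
by apply/eqP; rewrite -sqrf_eq0; apply: h; rewrite mem_index_enum.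
Qed.

Lemma two_distance_bound (R : realType) (n m : nat) (x : 'I_m -> 'rV[R]_n)
    (a b : R) :
  a < 1 -> b < 1 -> 0 <= a + b -> (forall i, dot (x i) (x i) = 1) ->
  (forall i j, i != j -> dot (x i) (x j) = a \/ dot (x i) (x j) = b) ->
  (m <= (n * (n + 1)) %/ 2)%N.
Proof.
move=> a1 b1 ab0 x1 xab; rewrite -card_upper_triangle.
set T := finset.finset _.
pose q i k l : R := x i 0 k * x i 0 l + a * b * (k == l)%:R.
(* Row [i] lists the upper triangular entries of the [i]-th symmetric matrix, so independent rows
   give [m <= #|T|]. *)
pose M : 'M[R]_(m, #|T|) :=
  \matrix_(i, t) q i (enum_val t).1 (enum_val t).2.
suff /eqP <- : row_free M by exact: rank_leq_col.
apply: inj_row_free => v vM0.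
pose c i := v 0 i.
have q0 k l : \sum_i c i * q i k l = 0.
  (* The relation [v *m M = 0] only speaks of entries with [k <= l]; symmetry of [q] in [k] and [l]
     gives the others. *)
  wlog kl : k l / (k <= l)%N => [hw|].
    have [/hw //|/ltnW /hw h] := leqP k l; rewrite -[RHS]h.
    by apply: eq_bigr => i _; rewrite /q eq_sym [x i 0 k * _]mulrC.
  have klT : (k, l) \in T by rewrite inE.
  have := congr1 (fun N : 'rV_ _ => N 0 (enum_rank_in klT (k, l))) vM0.
  rewrite !mxE => h; rewrite -[RHS]h; apply: eq_bigr => i _.
  by rewrite mxE enum_rankK_in.
have cx j : c j * ((1 - a) * (1 - b)) +
    (a + b) * dot (\sum_i c i *: x i) (x j) = 0.
  have : \sum_i c i * (dot (x i) (x j) ^+ 2 + a * b * dot (x j) (x j)) = 0.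
    under eq_bigr => i _ do rewrite dot_sqr_sum mulr_sumr.
    rewrite exchange_big big1 //= => k _.
    under eq_bigr => i _ do rewrite mulr_sumr.
    rewrite exchange_big big1 //= => l _.
    transitivity ((\sum_i c i * q i k l) * (x j 0 k * x j 0 l)).
      rewrite mulr_suml.
      by apply: eq_bigr => i _; rewrite -[RHS]mulrA.
    by rewrite q0 mul0r.
  (* For [i != j] the value [t] of the inner product satisfies [t^2 + ab = (a + b) t]. For [i = j]
     one has [1 + ab = (1 - a)(1 - b) + (a + b)], whence the extra term. *)
  rewrite x1 mulr1 => <-; rewrite dot_suml mulr_sumr.
  rewrite (bigD1 j) //= [RHS](bigD1 j) //= x1 dotZl x1 addrA; congr (_ + _).
    by ring.
  apply: eq_bigr => i ij; rewrite dotZl.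
  by case: (xab _ _ ij) => ->; ring.
have : (\sum_j c j ^+ 2) * ((1 - a) * (1 - b)) +
    (a + b) * dot (\sum_i c i *: x i) (\sum_i c i *: x i) = 0.
  rewrite [dot _ _]dot_sumr mulr_suml mulr_sumr -big_split big1 //= => j _.
  by rewrite dotZr -[RHS](mulr0 (c j)) -(cx j); ring.
have ab1 : 0 < (1 - a) * (1 - b) by rewrite mulr_gt0 ?subr_gt0.
have s0 : 0 <= \sum_j c j ^+ 2 by apply: sumr_ge0 => j _; exact: sqr_ge0.
have d0 := mulr_ge0 ab0 (dot_ge0 (\sum_i c i *: x i)).
move/eqP; rewrite paddr_eq0 //; last exact: mulr_ge0 s0 (ltW ab1).
move=> /andP[+ _].
rewrite mulf_eq0 (gt_eqF ab1) orbF => /eqP /sum_sqr_eq0 h.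
by apply/rowP => i; rewrite mxE; exact: h.
Qed.

Lemma admissible_card_le (R : realType) (n : nat) (S : set 'rV[R]_n) :
  rho_admissible S -> (S #<= `I_((n * (n + 1)) %/ 2))%card.
Proof.
move=> [a [b [[/andP[_ a1] /andP[_ b1] S1 Sab] ab0]]].
apply: card_le_seq => s s_uniq sS.
have xS (i : 'I_(size s)) : S s`_i by apply/sS/mem_nth.
apply: (two_distance_bound (x := fun i : 'I_(size s) => s`_i) a1 b1 ab0).
  by move=> i; exact: S1.
move=> i j ij; apply: Sab => // /eqP; rewrite nth_uniq // => /eqP /val_inj ijE.
by rewrite ijE eqxx in ij.
Qed.

(** * Lower bound: the regular simplex and its edges *)

Lemma sum_delta (R : pzRingType) (I : finType) (k : I) (f : I -> R) :
  \sum_h (h == k)%:R * f h = f k.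
Proof.
rewrite (bigD1 k) //= eqxx mul1r big1 ?addr0 // => h /negPf ->.
by rewrite mul0r.
Qed.

(* With [r = 1 / sqrt (n + 1)], the shifts [(r - 1) / n] and [- r] centre the
   simplex at the origin. *)
Definition simplex (R : realType) (n : nat) (i : 'I_n.+1) : 'rV[R]_n :=
  let r := (Num.sqrt n.+1%:R)^-1 in
  if unlift ord_max i is Some j then delta_mx 0 j + const_mx ((r - 1) / n%:R)
  else const_mx (- r).

(** This is the Gram matrix of the standard basis of [R^(n+1)] projected orthogonally to the
    all-ones vector, here realised in [n] coordinates. *)
Lemma dot_simplex (R : realType) (n : nat) (i j : 'I_n.+1) : (0 < n)%N ->
  dot (simplex R i) (simplex R j) = (i == j)%:R - n.+1%:R^-1.
Proof.
move=> n0; rewrite /simplex; set r := _^-1.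
have N0 : n%:R != 0 :> R by rewrite pnatr_eq0 -lt0n.
have N10 : n.+1%:R != 0 :> R by rewrite pnatr_eq0.
have rr : r ^+ 2 = n.+1%:R^-1 by rewrite exprVn sqr_sqrtr.
have Nr : n%:R = r ^- 2 - 1 :> R by rewrite rr invrK -natr1 addrK.
have r0 : r != 0 by rewrite -sqrf_eq0 rr invr_eq0.
have dd (k l : 'I_n) s t :
    dot (delta_mx 0 k + const_mx s) (delta_mx 0 l + const_mx t) =
    (k == l)%:R + s + t + n%:R * (s * t) :> R.
  rewrite /dot (eq_bigr (fun h => (h == k)%:R * ((h == l)%:R + t) +
     ((h == l)%:R * s + s * t))); last by move=> h _; rewrite !mxE /=; ring.
  rewrite !big_split /= !sum_delta sumr_const card_ord -[_ *+ n]mulr_natl.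
  by ring.
have dc (k : 'I_n) s t : dot (delta_mx 0 k + const_mx s) (const_mx t)
    = t + n%:R * (s * t) :> R.
  rewrite /dot (eq_bigr (fun h => (h == k)%:R * t + s * t)); last first.
    by move=> h _; rewrite !mxE /=; ring.
  by rewrite big_split /= sum_delta sumr_const card_ord mulr_natl.
have cc s t : dot (const_mx s) (const_mx t : 'rV_n) = n%:R * (s * t) :> R.
  rewrite /dot (eq_bigr (fun=> s * t)); last by move=> h _; rewrite !mxE.
  by rewrite sumr_const card_ord mulr_natl.
case: unliftP => [k ->|->]; case: unliftP => [l ->|->].
- rewrite dd (inj_eq (@lift_inj _ _)) -rr -!addrA; congr (_ + _).
  (* With [s = (r - 1) / n], the constant part is [2 s + n s^2 = (r^2 - 1) / n], which equals
     [- r^2] because [n = r^-2 - 1]. *)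
  have -> : (r - 1) / n%:R + ((r - 1) / n%:R +
      n%:R * ((r - 1) / n%:R * ((r - 1) / n%:R))) = (r ^+ 2 - 1) / n%:R.
    by field.
  by apply: (mulIf N0); rewrite mulfVK // Nr; field.
- by rewrite dc eq_sym (negPf (neq_lift _ _)) -rr mulr0n; field.
- by rewrite dotC dc (negPf (neq_lift _ _)) -rr mulr0n; field.
- by rewrite cc eqxx -rr Nr mulr1n; field.
Qed.

Lemma admissible_card_eq (R : realType) (n : nat) : (7 <= n)%N ->
  exists S : set 'rV[R]_n,
    rho_admissible S /\ (S #= `I_((n * (n + 1)) %/ 2))%card.
Proof.
move=> n7.
have [N NE] : exists N : R, N = n.+1%:R by exists n.+1%:R.
have N8 : 8 <= N by rewrite NE ler_nat.
(* The sum of two distinct simplex vectors has squared norm [2 (1 - 1/N) - 2/N = 2 - 4/N], so [c]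
   normalises it. *)
pose c : R := Num.sqrt (2 - 4 / N)^-1.
have N0 : N != 0 by lra.
have D0 : N - 2 != 0 by lra.
have cc : c ^+ 2 = N / (2 * (N - 2)).
  rewrite sqr_sqrtr; first by field; apply/and3P; split; lra.
  by rewrite invr_ge0 subr_ge0 ler_pdivrMr; lra.
pose D := [set A : {set 'I_n.+1} | #|A| == 2]%SET.
pose x (A : {set 'I_n.+1}) := c *: \sum_(i in A) simplex R i.
(* Summing the Gram entries over the four pairs in [A] times [B] gives [#|A :&: B| - 4/N], so only
   the number of common vertices matters; it is 0 or 1 for distinct edges. *)
have dot_x A B : A \in D -> B \in D ->
    dot (x A) (x B) = (#|A :&: B|%:R * N - 4) / (2 * (N - 2)).
  rewrite !inE => /eqP A2 /eqP B2.
  rewrite dotZl dotZr mulrA -expr2 cc dot_suml.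
  have -> : \sum_(i in A) dot (simplex R i) (\sum_(i0 in B) simplex R i0)
      = #|A :&: B|%:R - 4 / N.
    rewrite (eq_bigr (fun i => (i \in B)%:R - 2 / N)); last first.
      move=> i _; rewrite dot_sumr.
      rewrite (eq_bigr (fun j => (i == j)%:R - N^-1)); last first.
        by move=> j _; rewrite dot_simplex -?NE //; exact: leq_trans n7.
      rewrite sumrB sumr_const B2 mulr_natl; congr (_ - _).
      have [iB|iB] := boolP (i \in B).
        rewrite (bigD1 i) //= eqxx big1 ?addr0 // => j /andP[_].
        by rewrite eq_sym => /negPf ->.
      rewrite big1 // => j jB; case: eqP => // ij.
      by rewrite -ij (negPf iB) in jB.
    rewrite sumrB sumr_const A2; congr (_ - _); last by ring.
    rewrite -sum1_card natr_sum [RHS](eq_bigl _ _ (fun i => finset.in_setI i A B)).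
    by rewrite big_mkcondr; apply: eq_bigr => i _; case: (i \in B).
  by field; apply/andP.
have x1 A : A \in D -> dot (x A) (x A) = 1.
  move=> AD; rewrite dot_x // finset.setIid; move: AD; rewrite inE => /eqP ->.
  by field.
have xab A B : A \in D -> B \in D -> A != B ->
    dot (x A) (x B) = (N - 4) / (2 * (N - 2)) \/
    dot (x A) (x B) = - 4 / (2 * (N - 2)).
  move=> AD BD AB; rewrite dot_x //.
  have : (#|A :&: B| < 2)%N.
    move: AD BD; rewrite !inE => /eqP A2 /eqP B2.
    rewrite ltnNge; apply/negP => le2; move/eqP: AB; apply.
    have /eqP <- : A :&: B == A by rewrite eqEcard finset.subsetIl A2.
    by apply/eqP; rewrite eqEcard finset.subsetIr B2.
  case: #|_| => [|[|//]] _; [right|left]; by rewrite ?mul0r ?mul1r ?sub0r.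
have D2 : 0 < 2 * (N - 2) by lra.
have a1 : (N - 4) / (2 * (N - 2)) < 1 by rewrite ltr_pdivrMr //; lra.
have b1 : - 4 / (2 * (N - 2)) < 1 by rewrite ltr_pdivrMr //; lra.
have kD : ((n * (n + 1)) %/ 2)%N = #|D|.
  by rewrite card_draws card_ord bin2 addn1 divn2 mulnC.
rewrite kD; pose y (i : 'I_#|D|) := x (enum_val i).
exists (range y); split; last first.
  apply: card_eq_trans (inj_card_eq _) _; last by rewrite card_eq_sym card_II.
  (* Distinct edges give distinct points: otherwise their inner product would be 1, while both
     allowed values are below 1. *)
  move=> i j _ _ yij; apply: enum_val_inj; apply/eqP/negPn/negP => ij.
  have := xab _ _ (enum_valP i) (enum_valP j) ij.
  rewrite -/(y i) -/(y j) yij x1; last exact: enum_valP.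
  by case=> h; move: a1 b1; rewrite -h ltxx.
exists ((N - 4) / (2 * (N - 2))), (- 4 / (2 * (N - 2))); split; first split.
- by rewrite a1 ler_pdivlMr //; lra.
- by rewrite b1 ler_pdivlMr //; lra.
- by move=> _ [i _ <-]; exact/x1/enum_valP.
- move=> _ _ [i _ <-] [j _ <-] ij; apply: xab; try exact: enum_valP.
  by apply/eqP => ijE; apply: ij; rewrite /y ijE.
- by rewrite -mulrDl divr_ge0 //; lra.
Qed.

Theorem theorem2 (R : realType) (n : nat) (hn : (7 <= n)%N) :
  is_rho R n ((n * (n + 1)) %/ 2)%N.
Proof.
split; first exact: admissible_card_eq.
by move=> S; exact: admissible_card_le.
Qed.
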